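(* (i) Let $A=\mathrm{GF}(2)$ and $n\ge2$. The set of all permutations of $A^n$ which can be computed (without memory) by programs consisting only of binary instructions is the affine group $\mathrm{Aff}(n,2)$. (ii) Let $A$ be any finite alphabet with $|A|\ge2$ and let $n\ge 2$. When using one memory cell, every transformation $f$ of $A^n$ can be computed by binary instructions.
   Context: For $N\ge1$, a transformation of $A^N$ is a map $h=(h_1,\dots,h_N):A^N\to A^N$; its coordinate function $h_i:A^N\to A$ is trivial if $h_i(x)=x_i$ for all $x$. An instruction of $A^N$ is a transformation $g$ of $A^N$ with at most one nontrivial coordinate function $g_i$, written $y_i\gets g_i(y)$. The instruction is binary if $g_i$ depends on at most two variables, i.e. $g_i(y)=g_i(y_j,y_k)$ for some $j,k\in\{1,\dots,N\}$. A program computing $h$ is a finite sequence of instructions $g^1,\dots,g^L$ of $A^N$ with $h=g^L\circ\cdots\circ g^1$; computing $f:A^n\to A^n$ without memory means $N=n$ and $h=f$. Computing a transformation $f$ of $A^n$ with one memory cell means computing, by a program with instructions of $A^{n+1}$, some transformation $h$ of $A^{n+1}$ with $h_i(x_1,\dots,x_{n+1})=f_i(x_1,\dots,x_n)$ for all $1\le i\le n$ and all $(x_1,\dots,x_{n+1})\in A^{n+1}$. $\mathrm{Aff}(n,2)$ is the group of maps $x\mapsto xM+c$ on $\mathrm{GF}(2)^n$ with $M$ an invertible $n\times n$ matrix over $\mathrm{GF}(2)$ and $c\in\mathrm{GF}(2)^n$. *)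

(* Defs.v *)
From Stdlib Require List.
From HB Require Import structures.
From mathcomp Require Import all_boot all_order all_fingroup all_algebra.

Set Implicit Arguments.
Unset Strict Implicit.
Unset Printing Implicit Defensive.

Import GRing.Theory.
Local Open Scope ring_scope.

Definition transformation (A : Type) (N : nat) := 'rV[A]_N -> 'rV[A]_N.

Definition trivial_coord (A : Type) (N : nat) (g : transformation A N)
    (i : 'I_N) : Prop :=
  forall x, g x ord0 i = x ord0 i.

Definition updates_only (A : Type) (N : nat) (i : 'I_N)
    (g : transformation A N) : Prop :=
  forall j, j != i -> trivial_coord g j.

(* For N >= 1 this says that at most one coordinate function is nontrivial. *)
Definition instruction (A : Type) (N : nat) (g : transformation A N) : Prop :=
  exists i, updates_only i g.

(* The two variables may coincide, and either may be the updated one. *)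
Definition binary_coord (A : Type) (N : nat) (g : transformation A N)
    (i : 'I_N) : Prop :=
  exists (j k : 'I_N) (u : A -> A -> A),
    forall y, g y ord0 i = u (y ord0 j) (y ord0 k).

(* The index i is determined by g unless g is the identity, which is binary
   for every choice of i. *)
Definition binary_instruction (A : Type) (N : nat) (g : transformation A N) :
    Prop :=
  exists i, updates_only i g /\ binary_coord g i.

Lemma binary_instructionW (A : Type) (N : nat) (g : transformation A N) :
  binary_instruction g -> instruction g.
Proof. by case=> i [gi _]; exists i. Qed.

(* run [:: g1; ...; gL] = gL \o ... \o g1 *)
Fixpoint run (A : Type) (N : nat) (p : seq (transformation A N)) :
    transformation A N :=
  if p is g :: p' then run p' \o g else id.

Definition computable_by (A : Type) (N : nat) (I : transformation A N -> Prop)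
    (h : transformation A N) : Prop :=
  exists p : seq (transformation A N), List.Forall I p /\ h =1 run p.

(* The memory cell is the last coordinate of A^(n + 1): its initial content is
   arbitrary and its final content is unconstrained. *)
Definition computable_with_one_cell_by (A : Type) (n : nat)
    (I : transformation A (n + 1) -> Prop) (f : transformation A n) : Prop :=
  exists h : transformation A (n + 1),
    computable_by I h /\
    forall (x : 'rV[A]_(n + 1)) (i : 'I_n),
      h x ord0 (lshift 1 i) = f (lsubmx x) ord0 i.

Definition Aff2 (n : nat) : {set {perm 'rV['F_2]_n}} :=
  [set s : {perm 'rV['F_2]_n} |
    [exists M : 'M['F_2]_n, exists c : 'rV['F_2]_n,
      (M \in unitmx) && [forall x, s x == x *m M + c]]].

Lemma Aff2P (n : nat) (s : {perm 'rV['F_2]_n}) :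
  reflect (exists (M : 'M['F_2]_n) (c : 'rV['F_2]_n),
             M \in unitmx /\ forall x, s x = x *m M + c)
          (s \in Aff2 n).
Proof.
rewrite inE; apply: (iffP existsP) => [[M /existsP[c /andP[Mu /forallP sE]]]|].
  by exists M, c; split=> // x; apply/eqP.
case=> M [c [Mu sE]]; exists M; apply/existsP; exists c; rewrite Mu /=.
by apply/forallP => x; apply/eqP.
Qed.

Lemma Aff2_group_set (n : nat) : group_set (Aff2 n).
Proof.
apply/group_setP; split.
  apply/Aff2P; exists 1%:M, 0; split; first exact: unitmx1.
  by move=> x; rewrite perm1 mulmx1 addr0.
move=> s t /Aff2P[M [c [Mu sE]]] /Aff2P[M' [c' [Mu' tE]]].
apply/Aff2P; exists (M *m M'), (c *m M' + c'); split.
  by rewrite unitmx_mul Mu.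
by move=> x; rewrite permM sE tE mulmxDl mulmxA addrA.
Qed.

Canonical Aff2_group (n : nat) := Group (Aff2_group_set n).

(* Main.v *)
Require Import Defs.
From mathcomp Require Import all_boot all_order all_fingroup all_algebra.

(** (i) The run of a program can only be injective if each of its instructions
    is; an injective binary instruction over GF(2) has the form
    [y_i <- y_i + v(y_k)], and every [v : GF(2) -> GF(2)] is affine. Conversely,
    block elimination writes an invertible matrix over GF(2) as a product of
    transvections, and a transvection is the instruction [y_j <- y_j + y_i].

    (ii) The memory cell can build up, one binary instruction at a time, the
    truth value of the conjunction of the tests [y_k = a_k], [k != i], and can
    then control an update of [y_i]. This yields every map supported on two
    states that differ in one coordinate; conjugating along paths in the Hamming
    graph yields all transpositions and all merges of two states, and these
    generate the full transformation monoid. *)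

Set Implicit Arguments.
Unset Strict Implicit.
Unset Printing Implicit Defensive.

Import GRing.Theory.
Local Open Scope ring_scope.

(** Closure under [=1] stands in for functional extensionality. *)
Definition composition_closed (T : Type) (P : (T -> T) -> Prop) : Prop :=
  [/\ P id, forall f g, f =1 g -> P f -> P g
    & forall f g, P f -> P g -> P (g \o f)].

(** For [a != b] this is an idempotent of defect 1; together with the permutations such maps
    generate the full transformation monoid. *)
Definition merge (T : eqType) (a b : T) : T -> T := [fun x => x with a |-> b].

Definition upd (A : Type) (N : nat) (y : 'rV[A]_N) (i : 'I_N) (v : A) :
    'rV[A]_N :=
  \row_j (if j == i then v else y ord0 j).

(** * Programs *)

Lemma run_cat (A : Type) (N : nat) (p q : seq (transformation A N)) y :
  run (p ++ q) y = run q (run p y).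
Proof. by elim: p y => //= g p IHp y; rewrite IHp. Qed.

Lemma Forall_cat (T : Type) (P : T -> Prop) (s t : seq T) :
  List.Forall P s -> List.Forall P t -> List.Forall P (s ++ t).
Proof.
move=> Ps Pt; elim: s Ps => [//|x s IHs] /= Pxs.
by constructor; [exact: List.Forall_inv Pxs | exact/IHs/(List.Forall_inv_tail Pxs)].
Qed.

Lemma computable_by_closed (A : Type) (N : nat)
    (I : transformation A N -> Prop) :
  composition_closed (computable_by I).
Proof.
split=> [|f g fg [p [Ip fp]]|f g [p [Ip fp]] [q [Iq gq]]].
- by exists [::]; split; first exact: List.Forall_nil.
- by exists p; split=> // x; rewrite -fg.
- by exists (p ++ q); split=> [|x]; [exact: Forall_cat | rewrite run_cat /= fp gq].
Qed.

Lemma computable_by1 (A : Type) (N : nat) (I : transformation A N -> Prop) g :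
  I g -> computable_by I g.
Proof.
by move=> Ig; exists [:: g]; split=> //; constructor=> //; exact: List.Forall_nil.
Qed.

Lemma binary_upd (A : Type) (N : nat) (i j k : 'I_N) (u : A -> A -> A) :
  binary_instruction (fun y => upd y i (u (y ord0 j) (y ord0 k))).
Proof.
exists i; split=> [l /negPf li y|]; first by rewrite mxE li.
by exists j, k, u => y; rewrite mxE eqxx.
Qed.

(** * Affine maps over GF(2) *)

Lemma F2P (x : 'F_2) : x = 0 \/ x = 1.
Proof. by case: x => [[|[|m]] ltm] //; [left|right]; exact: val_inj. Qed.

Lemma F2_neq (x y : 'F_2) : x <> y -> x = y + 1.
Proof.
by case: (F2P x) => ->; case: (F2P y) => -> // _; exact: val_inj.
Qed.

Lemma F2_fun_affine (v : 'F_2 -> 'F_2) t : v t = v 0 + (v 1 - v 0) * t.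
Proof.
by case: (F2P t) => ->; rewrite ?mulr0 ?addr0 // mulr1 addrC subrK.
Qed.

Lemma updE_F2 n (y : 'rV['F_2]_n) i v :
  upd y i (y ord0 i + v) = y + v *: delta_mx ord0 i.
Proof.
apply/rowP=> j; rewrite !mxE eqxx /=.
by case: eqP => [->|_]; rewrite ?mulr1 ?mulr0 ?addr0.
Qed.

(** Injectivity forces [y_i] to be among the variables read, and over GF(2) flipping [y_i] must then
    flip the new value; hence the value is [y_i] plus a function of one variable. *)
Lemma injective_binary_coord_F2 n (g : transformation 'F_2 n) i :
  updates_only i g -> binary_coord g i -> injective g ->
  exists (k : 'I_n) (c d : 'F_2),
    forall x, g x ord0 i = x ord0 i + (c + d * x ord0 k).
Proof.
move=> gi [j [k [u gE]]] g_inj.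
(* Two states that differ only at [i] have images that agree off [i], so the images must differ at
   [i]. *)
have dep x : g (upd x i 0) ord0 i <> g (upd x i 1) ord0 i.
  move=> eq_i; suff /g_inj/rowP/(_ i): g (upd x i 0) = g (upd x i 1).
    by rewrite !mxE eqxx.
  apply/rowP=> l; have [->//|li] := eqVneq l i.
  by rewrite !gi // !mxE (negPf li).
have affine (v : 'F_2 -> 'F_2) l :
    (forall x, g x ord0 i = x ord0 i + v (x ord0 l)) ->
  exists (k : 'I_n) (c d : 'F_2),
    forall x, g x ord0 i = x ord0 i + (c + d * x ord0 k).
  by move=> gv; exists l, (v 0), (v 1 - v 0) => x; rewrite -F2_fun_affine.
have [ji|ji] := eqVneq j i; have [ki|ki] := eqVneq k i.
- by apply: (affine (fun t => u t t - t) i) => x; rewrite gE ji ki addrC subrK.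
(* Here [dep] says [u 1 t <> u 0 t], that is [u 1 t = u 0 t + 1], so [u s t = s + u 0 t]. *)
- apply: (affine (u 0) k) => x; rewrite gE ji.
  case: (F2P (x ord0 i)) => ->; first by rewrite add0r.
  have := dep x; rewrite !gE !mxE ji eqxx (negPf ki) => /nesym/F2_neq ->.
  exact: addrC.
- apply: (affine (u^~ 0) j) => x; rewrite gE ki.
  case: (F2P (x ord0 i)) => ->; first by rewrite add0r.
  have := dep x; rewrite !gE !mxE ki eqxx (negPf ji) => /nesym/F2_neq ->.
  exact: addrC.
(* If neither variable read is [y_i], the new value ignores [y_i], against [dep]. *)
- by have := dep 0; rewrite !gE !mxE (negPf ji) (negPf ki).
Qed.

Lemma mul_rV_delta (R : pzRingType) m n (x : 'rV[R]_m) (k : 'I_m) (i : 'I_n) :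
  x *m delta_mx k i = x ord0 k *: delta_mx ord0 i.
Proof.
apply/rowP=> j; rewrite !mxE (bigD1 k) //= !mxE !eqxx big1 ?addr0 // => l /negPf lk.
by rewrite mxE lk mulr0.
Qed.

Lemma injective_binary_affine n (g : transformation 'F_2 n) :
  binary_instruction g -> injective g ->
  exists (M : 'M['F_2]_n) c, forall x, g x = x *m M + c.
Proof.
case=> i [gi gb] /(injective_binary_coord_F2 gi gb)[k [c [d gE]]].
exists (1%:M + d *: delta_mx k i), (c *: delta_mx ord0 i) => x.
have ->: g x = upd x i (g x ord0 i).
  by apply/rowP=> j; rewrite mxE; case: eqVneq => [->|/gi].
rewrite gE updE_F2 mulmxDr mulmx1 -scalemxAr mul_rV_delta scalerA -addrA.
by rewrite -scalerDl [c + _]addrC.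
Qed.

Lemma injective_run_affine n (p : seq (transformation 'F_2 n)) :
  List.Forall (@binary_instruction 'F_2 n) p -> injective (run p) ->
  exists (M : 'M['F_2]_n) c, forall x, run p x = x *m M + c.
Proof.
elim: p => [|g p IHp] /=; first by exists 1%:M, 0 => x; rewrite mulmx1 addr0.
move=> bgp gp_inj; have bg := List.Forall_inv bgp.
have bp := List.Forall_inv_tail bgp.
(* The instruction [g] runs first and so inherits injectivity; by finiteness it is bijective, and
   its inverse transfers injectivity to the rest of the program. *)
have g_inj : injective g by exact: inj_compr gp_inj.
have [g' gK g'K] := injF_bij g_inj.
have p_inj : injective (run p).
  by move=> x y; rewrite -(g'K x) -(g'K y) => /gp_inj ->.
have [N [d pE]] := IHp bp p_inj.
have [M [c gE]] := injective_binary_affine bg g_inj.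
exists (M *m N), (c *m N + d) => x.
by rewrite pE gE mulmxDl mulmxA addrA.
Qed.

Lemma affine_injective_unitmx (F : fieldType) n (M : 'M[F]_n) c :
  injective (fun x : 'rV[F]_n => x *m M + c) -> M \in unitmx.
Proof.
move=> inj; rewrite -row_free_unit; apply: inj_row_free => v vM0.
by apply: inj; rewrite vM0 mul0mx.
Qed.

(** * Invertible matrices over GF(2) as products of transvections *)

(** Over GF(2) the only nonzero coefficient is 1 and every transvection is its own inverse, so this
    monoid is already a group. *)
Inductive transvection_product (n : nat) : 'M['F_2]_n -> Prop :=
| Transvection_product1 : transvection_product 1%:M
| Transvection (i j : 'I_n) of i != j :
    transvection_product (1%:M + delta_mx i j)
| Transvection_productM (M N : 'M['F_2]_n) of
    transvection_product M & transvection_product N :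
    transvection_product (M *m N).

Lemma transvection_product_lift0 n (M : 'M['F_2]_n) :
  transvection_product M ->
  transvection_product (block_mx 1%:M 0 0 M : 'M_(1 + n)).
Proof.
elim=> {M} [|i j ij|M N _ IHM _ IHN].
- by rewrite -scalar_mx_block; exact: Transvection_product1.
- suff ->: block_mx 1%:M 0 0 (1%:M + delta_mx i j) =
      1%:M + delta_mx (rshift 1 i) (rshift 1 j) :> 'M['F_2]_(1 + n).
    by apply: Transvection; rewrite (inj_eq (@rshift_inj _ _)).
  rewrite (scalar_mx_block 1 n) delta_mx_dshift delta_mx_rshift.
  by rewrite /block_mx add_col_mx add_row_mx !addr0.
- suff ->: block_mx 1%:M 0 0 (M *m N) =
      block_mx 1%:M 0 0 M *m block_mx 1%:M 0 0 N :> 'M['F_2]_(1 + n).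
    exact: Transvection_productM.
  by rewrite mulmx_block !(mul0mx, mulmx0, mul1mx, addr0, add0r).
Qed.

(** The block matrix turns sums of columns [v] into products, and for a unit column it is a single
    transvection. *)
Lemma transvection_product_lower n (v : 'cV['F_2]_n) :
  transvection_product (block_mx 1%:M 0 v 1%:M : 'M_(1 + n)).
Proof.
rewrite [v]matrix_sum_delta.
elim/big_ind: _ => [|w w' IHw IHw'|i _].
- by rewrite -scalar_mx_block; exact: Transvection_product1.
- suff ->: block_mx 1%:M 0 (w + w') 1%:M =
      block_mx 1%:M 0 w 1%:M *m block_mx 1%:M 0 w' 1%:M :> 'M['F_2]_(1 + n).
    exact: Transvection_productM.
  by rewrite mulmx_block !(mul0mx, mulmx0, mul1mx, mulmx1, addr0, add0r).
rewrite big_ord1; case: (F2P (v i 0)) => ->; rewrite (scale0r, scale1r).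
  by rewrite -scalar_mx_block; exact: Transvection_product1.
suff ->: block_mx 1%:M 0 (delta_mx i 0) 1%:M =
    1%:M + delta_mx (rshift 1 i) (lshift n 0) :> 'M['F_2]_(1 + n).
  by apply: Transvection; rewrite eq_rlshift.
rewrite (scalar_mx_block 1 n) delta_mx_dshift delta_mx_lshift.
by rewrite /block_mx add_col_mx add_row_mx !(addr0, add0r).
Qed.

Lemma transvection_product_upper n (v : 'rV['F_2]_n) :
  transvection_product (block_mx 1%:M v 0 1%:M : 'M_(1 + n)).
Proof.
rewrite [v]row_sum_delta.
elim/big_ind: _ => [|w w' IHw IHw'|i _].
- by rewrite -scalar_mx_block; exact: Transvection_product1.
- suff ->: block_mx 1%:M (w + w') 0 1%:M =
      block_mx 1%:M w 0 1%:M *m block_mx 1%:M w' 0 1%:M :> 'M['F_2]_(1 + n).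
    exact: Transvection_productM.
  by rewrite mulmx_block !(mul0mx, mulmx0, mul1mx, mulmx1, addr0, add0r) addrC.
case: (F2P (v 0 i)) => ->; rewrite (scale0r, scale1r).
  by rewrite -scalar_mx_block; exact: Transvection_product1.
suff ->: block_mx 1%:M (delta_mx 0 i) 0 1%:M =
    1%:M + delta_mx (lshift n 0) (rshift 1 i) :> 'M['F_2]_(1 + n).
  by apply: Transvection; rewrite eq_lrshift.
rewrite (scalar_mx_block 1 n) delta_mx_ushift delta_mx_rshift.
by rewrite /block_mx add_col_mx add_row_mx !(addr0, add0r).
Qed.

(** Induction on the size: a pivot 1 in the corner reduces to the Schur complement, and a pivot 0 is
    first repaired by one column addition. *)
Lemma unitmx_transvection_product n (M : 'M['F_2]_n) :
  M \in unitmx -> transvection_product M.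
Proof.
elim: n => [|n IHn] in M *.
  by move=> _; have -> : M = 1%:M by [apply/matrixP=> -[]]; exact: Transvection_product1.
rewrite -[n.+1]/(1 + n)%N in M *.
have pivot1 (N : 'M['F_2]_(1 + n)) :
    N 0 0 = 1 -> N \in unitmx -> transvection_product N.
  move=> N00; rewrite -[N]submxK.
  have ->: ulsubmx N = 1%:M.
    by apply/matrixP=> i j; rewrite !ord1 !mxE !lshift0.
  move: (ursubmx N) (dlsubmx N) (drsubmx N) => w v D.
  (* Block LDU factorization; the middle factor carries the Schur complement [D - v *m w]. *)
  have ->: block_mx 1%:M w v D = block_mx 1%:M 0 v 1%:M *m
      block_mx 1%:M 0 0 (D - v *m w) *m block_mx 1%:M w 0 1%:M.
    rewrite !mulmx_block !(mul0mx, mulmx0, mul1mx, mulmx1, addr0, add0r).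
    by rewrite addrC subrK.
  rewrite !unitmx_mul => /andP[/andP[_ uD] _].
  apply: Transvection_productM (transvection_product_upper w).
  apply: Transvection_productM; first exact: transvection_product_lower.
  apply/transvection_product_lift0/IHn.
  by move: uD; rewrite !unitmxE det_ublock det1 mul1r.
move=> uM; have [M00|] := F2P (M 0 0); last by move/pivot1; apply.
(* An invertible matrix has no zero row, and a nonzero entry of GF(2) is 1. *)
have [j M0j]: exists j, M 0 j = 1.
  case: (pickP (fun j => M 0 j == 1)) => [j /eqP|M0]; first by exists j.
  have: row 0 M = 0.
    by apply/rowP=> j; rewrite !mxE; have [//|/eqP] := F2P (M 0 j); rewrite M0.
  move/(congr1 (mulmx^~ (invmx M))); rewrite mul0mx -row_mul mulmxV //.
  by move/rowP/(_ 0); rewrite !mxE eqxx.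
have j0 : j != 0 by apply: contra_eq_neq M0j => ->; rewrite M00.
(* Right multiplication by [T] adds column [j] to column 0, making the pivot [0 + 1]. As [T] is an
   involution, [M = (M *m T) *m T]. *)
pose T : 'M['F_2]_(1 + n) := 1%:M + delta_mx j 0.
have TT : T *m T = 1%:M.
  rewrite mulmxDl mulmxDr mulmx1 mul1mx mulmxDr mulmx1.
  rewrite mul_delta_mx_0 1?eq_sym // addr0 -addrA -mulr2n -scaler_nat.
  by rewrite (_ : 2%:R = 0 :> 'F_2) ?scale0r ?addr0 //; exact: val_inj.
rewrite -[M]mulmx1 -TT mulmxA.
apply: Transvection_productM; last exact: Transvection.
apply: pivot1; last by rewrite unitmx_mul uM; case/mulmx1_unit: TT.
transitivity (row 0 (M *m T) 0 0); first by rewrite [RHS]mxE.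
by rewrite row_mul mulmxDr mulmx1 mul_rV_delta !mxE M00 M0j !eqxx add0r mulr1.
Qed.

(** * Programs for affine permutations *)

Lemma unitmx_computable n (M : 'M['F_2]_n) :
  M \in unitmx ->
  computable_by (@binary_instruction 'F_2 n) (fun x => x *m M).
Proof.
have [Pid Peq Pcomp] := computable_by_closed (@binary_instruction 'F_2 n).
move/unitmx_transvection_product; elim=> {M} [|i j _|M N _ PM _ PN].
- by apply: (Peq id) => // x; rewrite mulmx1.
- apply: (Peq (fun x => upd x j (x ord0 j + x ord0 i))) => [x|].
    by rewrite updE_F2 mulmxDr mulmx1 mul_rV_delta.
  exact/computable_by1/(binary_upd j j i +%R).
- by apply: Peq (Pcomp _ _ PM PN) => x /=; rewrite mulmxA.
Qed.

Lemma translation_computable n (c : 'rV['F_2]_n) :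
  computable_by (@binary_instruction 'F_2 n) (fun x => x + c).
Proof.
have [Pid Peq Pcomp] := computable_by_closed (@binary_instruction 'F_2 n).
rewrite [c]row_sum_delta; elim/big_ind: _ => [|d d' Pd Pd'|i _].
- by apply: (Peq id) => // x; rewrite addr0.
- by apply: Peq (Pcomp _ _ Pd Pd') => x /=; rewrite addrA.
- apply: (Peq _ _ (fun x => updE_F2 x i (c ord0 i))).
  exact/computable_by1/(binary_upd i i i (fun t _ => t + c ord0 i)).
Qed.

Lemma binary_computable_perm_F2 n (s : {perm 'rV['F_2]_n}) :
  computable_by (@binary_instruction 'F_2 n) s <-> s \in Aff2 n.
Proof.
have [_ Peq Pcomp] := computable_by_closed (@binary_instruction 'F_2 n).
split=> [[p [bp sE]]|/Aff2P[M [c [uM sE]]]]; last first.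
  apply: Peq (Pcomp _ _ (unitmx_computable uM) (translation_computable c)).
  by move=> x; rewrite /= sE.
have run_inj : injective (run p) by exact: (eq_inj (@perm_inj _ s)).
have [M [c pE]] := injective_run_affine bp run_inj.
apply/Aff2P; exists M, c; split=> [|x]; last by rewrite sE.
exact/affine_injective_unitmx/(eq_inj run_inj pE).
Qed.

(** * Generating the full transformation monoid *)

(** Permutations are products of transpositions. Other maps are treated by induction on the number
    of missed values: one of two colliding points is redirected to a missed value, and a final merge
    undoes this. *)
Lemma transformation_generation (T : finType) (P : (T -> T) -> Prop) :
  composition_closed P ->
  (forall a b, P (tperm a b) /\ P (merge a b)) ->
  forall f, P f.
Proof.
move=> [Pid Peq Pcomp] Pab.
have Pperm (s : {perm T}) : P s.
  have [ts -> _] := prod_tpermP s.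
  elim: ts => [|t ts IHts]; first by apply: (Peq id) => // x; rewrite big_nil perm1.
  apply: Peq (Pcomp _ _ (Pab t.1 t.2).1 IHts) => x.
  by rewrite big_cons permM.
move=> f; have [m] := ubnP #|~: (f @: [set: T])|.
elim: m f => // m IHm f; rewrite ltnS => le_f_m.
have [/injectiveP f_inj|/injectivePn[a [b ab fab]]] := boolP (injectiveb f).
  by apply: Peq (Pperm (perm f_inj)) => x; rewrite permE.
(* On a finite type a map that is not injective misses some value. *)
have [c c_im] : exists c, c \in ~: (f @: [set: T]).
  apply/set0Pn; apply: contra_neq ab => im_all.
  suff f_inj: {in [set: T] &, injective f} by apply: f_inj; rewrite ?inE.
  by apply/imset_injP; rewrite -[f @: _]setCK im_all setC0.
pose f' x := if x == b then c else f x.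
apply: (Peq (merge c (f a) \o f')) => [x|].
  rewrite /merge /f' /=; have [->|_] := eqVneq x b; first by rewrite eqxx fab.
  case: eqP => // fxc; move: c_im; rewrite inE -fxc => /imsetP[].
  by exists x; rewrite ?inE.
apply: Pcomp (Pab c (f a)).2; apply: IHm; apply: leq_trans le_f_m.
(* The image of [f'] gains [c] and loses nothing, since [a] still attains the value [f b]. *)
apply/proper_card/properP; split; last first.
  by exists c => //; rewrite inE negbK; apply/imsetP; exists b; rewrite /f' ?eqxx ?inE.
rewrite setCS; apply/subsetP=> _ /imsetP[x _ ->]; apply/imsetP.
have [->|xb] := eqVneq x b.
  by exists a; rewrite ?inE // /f' (negPf ab).
by exists x; rewrite ?inE // /f' (negPf xb).
Qed.

Lemma exchange_refl (T : finType) (P : (T -> T) -> Prop) a :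
  composition_closed P -> P (tperm a a) /\ P (merge a a).
Proof.
case=> Pid Peq _; split; apply: (Peq id) => // x.
  by rewrite tperm1 perm1.
by rewrite /merge /=; case: eqP.
Qed.

(** For distinct points, conjugation by [tperm a b] carries [tperm b c] to [tperm a c] and
    [merge b c] to [merge a c]. *)
Lemma exchange_trans (T : finType) (P : (T -> T) -> Prop) a b c :
  composition_closed P ->
  P (tperm a b) /\ P (merge a b) -> P (tperm b c) /\ P (merge b c) ->
  P (tperm a c) /\ P (merge a c).
Proof.
move=> Pc Pab Pbc; have [Pid Peq Pcomp] := Pc.
have [<-|ac] := eqVneq a c; first exact: exchange_refl.
have [<-//|bc] := eqVneq b c; have [->//|ab] := eqVneq a b.
have conj f : P f -> P (tperm a b \o (f \o tperm a b)).
  by move=> Pf; apply: (Pcomp _ _ _ Pab.1); exact: Pcomp Pab.1 Pf.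
split; [apply: Peq (conj _ Pbc.1) | apply: Peq (conj _ Pbc.2)] => x /=.
  have ->: tperm a c = (tperm b c ^ tperm a b)%g by rewrite tpermJ tpermR tpermD.
  by rewrite /conjg tpermV !permM.
rewrite /merge /=; case: (tpermP a b x) => [->|->|/eqP/negPf xa /eqP/negPf xb].
- by rewrite !eqxx tpermD.
- by rewrite (negPf ab) eq_sym (negPf ab) tpermL.
- by rewrite xa xb tpermD // eq_sym ?xa ?xb.
Qed.

(** * Lines and paths in the Hamming graph *)

Lemma upd_id (A : Type) (N : nat) (x : 'rV[A]_N) i : upd x i (x ord0 i) = x.
Proof. by apply/rowP=> j; rewrite mxE; case: eqP => [->|]. Qed.

(** The condition says that [x] lies on the line through [a] in direction [i]. *)
Definition line_map (A : finType) (N : nat) (a : 'rV[A]_N) (i : 'I_N)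
    (t : A -> A) (x : 'rV[A]_N) : 'rV[A]_N :=
  if x == upd a i (x ord0 i) then upd a i (t (x ord0 i)) else x.

Lemma line_map_upd (A : finType) (N : nat) (a : 'rV[A]_N) i t v :
  line_map a i t (upd a i v) = upd a i (t v).
Proof. by rewrite /line_map mxE !eqxx. Qed.

Lemma line_map_out (A : finType) (N : nat) (a : 'rV[A]_N) i t x :
  (forall v, x != upd a i v) -> line_map a i t x = x.
Proof. by move=> xa; rewrite /line_map (negPf (xa _)). Qed.

Lemma upd_inj (A : Type) (N : nat) (a : 'rV[A]_N) i : injective (upd a i).
Proof. by move=> v w /rowP/(_ i); rewrite !mxE eqxx. Qed.

(** Exchanges and merges of two states on a common line are line maps; paths that change one
    coordinate at a time extend this to any two states. *)
Lemma line_generation (A : finType) (N : nat)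
    (P : ('rV[A]_N -> 'rV[A]_N) -> Prop) :
  composition_closed P -> (forall a i t, P (line_map a i t)) -> forall f, P f.
Proof.
move=> Pc Pline; have [_ Peq _] := Pc.
have adjacent a i w : P (tperm a (upd a i w)) /\ P (merge a (upd a i w)).
  have lineP (f : 'rV[A]_N -> 'rV[A]_N) t :
      (forall v, f (upd a i v) = upd a i (t v)) ->
      (forall x, (forall v, x != upd a i v) -> f x = x) -> P f.
    move=> f_in f_out; apply: Peq (Pline a i t) => x.
    have [/existsP[v /eqP->]|] := boolP [exists v, x == upd a i v].
      by rewrite line_map_upd f_in.
    rewrite negb_exists => /forallP xa.
    by rewrite line_map_out // f_out.
  split.
    (* The state [a] is the point of its own line with parameter [a ord0 i], so the transposition
       acts on parameters. *)
    apply: (lineP _ (tperm (a ord0 i) w)) => [v|x xa].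
      by rewrite -{1}(upd_id a i) (inj_tperm _ _ _ (@upd_inj _ _ a i)).
    by rewrite tpermD // eq_sym // -(upd_id a i).
  apply: (lineP _ (merge (a ord0 i) w)) => [v|x xa].
    by rewrite /merge /= -{2}(upd_id a i) (inj_eq (@upd_inj _ _ a i)); case: eqP.
  by rewrite /merge /= -{1}(upd_id a i) (negPf (xa _)).
apply: transformation_generation => // a b.
(* The partial folds are the vertices of a path from [a] to [b] that overwrites one coordinate per
   step. *)
have ->: b = foldr (fun i z => upd z i (b ord0 i)) a (enum 'I_N).
  apply/rowP=> j; have: j \in enum 'I_N by rewrite mem_enum.
  elim: (enum _) => //= i s IHs; rewrite inE mxE.
  by case: eqVneq => [->|_ /IHs].
elim: (enum _) => [|i s IHs] /=; first exact: exchange_refl.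
exact: exchange_trans IHs (adjacent _ _ _).
Qed.

(** * One memory cell *)

(** Programs can be chained because each one is correct for every initial content of the cell,
    including what its predecessor left there. *)
Lemma one_cell_closed (A : Type) (n : nat)
    (I : transformation A (n + 1) -> Prop) :
  composition_closed (computable_with_one_cell_by I).
Proof.
have [Pid _ Pcomp] := computable_by_closed I.
split=> [|f g fg [h [Ph hf]]|f g [h [Ph hf]] [k [Pk kg]]].
- by exists id; split=> // x i; rewrite mxE.
- by exists h; split=> // x i; rewrite -fg.
- exists (k \o h); split=> [|x i /=]; first exact: Pcomp.
  by rewrite kg (_ : lsubmx (h x) = f (lsubmx x)) //; apply/rowP=> j; rewrite mxE.
Qed.

(** The letters [c1] and [c0] encode true and false. Each test reads only the cell and one
    coordinate, so the conjunction accumulates in the cell by binary instructions. *)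
Lemma conjunction_of_tests (A : eqType) (n : nat) (c0 c1 : A) (a : 'rV[A]_n)
    (s : seq 'I_n) :
  c0 != c1 ->
  exists h : transformation A (n + 1),
    computable_by (@binary_instruction A (n + 1)) h /\
    forall y, h y = upd y (rshift n ord0)
      (if all (fun k => y ord0 (lshift 1 k) == a ord0 k) s then c1 else c0).
Proof.
move=> c01; have [_ _ Pcomp] :=
  computable_by_closed (@binary_instruction A (n + 1)).
pose m : 'I_(n + 1) := rshift n ord0.
elim: s => [|k s [h [Ph hE]]].
  (* The empty conjunction is true; this constant instruction also erases the unknown initial
     content. *)
  exists (fun y => upd y m c1); split=> //.
  exact/computable_by1/(binary_upd m m m (fun _ _ => c1)).
pose u v w := if (v == c1) && (w == a ord0 k) then c1 else c0.
pose g y := upd y m (u (y ord0 m) (y ord0 (lshift 1 k))).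
exists (g \o h); split=> [|y].
  exact/(Pcomp _ _ Ph)/computable_by1/binary_upd.
rewrite /= hE; apply/rowP=> j; rewrite !mxE eqxx eq_lrshift.
rewrite -/m; case: (j == m) => //; rewrite /u andbC.
by case: (all _ s); rewrite ?eqxx // (negPf c01).
Qed.

Lemma line_map_one_cell (A : finType) (n : nat) (a : 'rV[A]_n) i t :
  (2 <= #|A|)%N ->
  computable_with_one_cell_by (@binary_instruction A (n + 1)) (line_map a i t).
Proof.
case/card_gt1P=> c0 [c1 [_ _ c01]].
have [_ _ Pcomp] := computable_by_closed (@binary_instruction A (n + 1)).
(* Leaving out the test at [i] makes the cell record whether the state lies on the line. The update
   [g] then needs only the cell and [y_i]. *)
have [h [Ph hE]] := conjunction_of_tests a [seq k <- enum 'I_n | k != i] c01.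
pose m : 'I_(n + 1) := rshift n ord0.
pose u v w := if v == c1 then t w else w.
pose g y := upd y (lshift 1 i) (u (y ord0 m) (y ord0 (lshift 1 i))).
exists (g \o h); split=> [|y l].
  exact/(Pcomp _ _ Ph)/computable_by1/binary_upd.
rewrite /= hE !mxE eqxx !eq_lrshift (inj_eq (@lshift_inj _ _)) /line_map mxE.
set b := all _ _.
have ->: (lsubmx y == upd a i (y ord0 (lshift 1 i))) = b.
  apply/eqP/allP => [ya k|ya].
    rewrite mem_filter => /andP[/negPf ki _].
    by move/rowP/(_ k): ya; rewrite !mxE ki => ->.
  apply/rowP=> k; rewrite !mxE; have [->//|ki] := eqVneq k i.
  by apply/eqP/ya; rewrite mem_filter ki mem_enum.
rewrite /u; case: (boolP b) => [/allP ya|_]; last first.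
  by rewrite (negPf c01) !mxE; case: eqP => [->|].
rewrite eqxx !mxE; case: (eqVneq l i) => // li.
by apply/eqP/ya; rewrite mem_filter li mem_enum.
Qed.

Theorem theorem6 :
  (forall n : nat, (2 <= n)%N ->
     forall s : {perm 'rV['F_2]_n},
       computable_by (@binary_instruction 'F_2 n) s <-> s \in Aff2 n) /\
  (forall (A : finType) (n : nat), (2 <= #|A|)%N -> (2 <= n)%N ->
     forall f : transformation A n,
       computable_with_one_cell_by (@binary_instruction A (n + 1)%N) f).
Proof.
split=> [n _ s|A n A2 _ f]; first exact: binary_computable_perm_F2.
apply: (line_generation (one_cell_closed _)) => a i t.
exact: line_map_one_cell.
Qed.
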